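(* If $D$ is an admissible divisor on a compact discrete Riemann surface $(\Sigma,\Lambda,z)$ of genus $g$, then $$l(-D)=\deg D-2g+2+i(D).$$
   Context: A surface means a connected oriented surface without boundary. A bipartite quad-decomposition $\Lambda$ of a surface $\Sigma$ is a cellular decomposition of $\Sigma$ that is locally finite (a compact subset of $\Sigma$ contains only finitely many faces) and strongly regular (two different faces are either disjoint or share only one vertex or share only one edge), all of whose 2-cells are quadrilaterals and whose 1-skeleton is bipartite. $V(\Lambda)$ and $F(\Lambda)$ are the sets of vertices and faces; $V(\Diamond)$ is the vertex set of the dual graph $\Diamond=\Lambda^*$, identified with $F(\Lambda)$. A decomposition of $V(\Lambda)$ into two independent sets (black and white vertices) is fixed. For $Q\in F(\Lambda)$ with vertices $b_-,w_-,b_+,w_+$ in counterclockwise order ($b_\pm$ black, $w_\pm$ white), a chart $z_Q$ of $Q$ is an orientation-preserving embedding of $Q$ onto a rectilinear quadrilateral in $\mathbb{C}$ without self-intersections such that the images of $b_-,w_-,b_+,w_+$ are its vertices. Put $\rho_Q:=-i\,\frac{z_Q(w_+)-z_Q(w_-)}{z_Q(b_+)-z_Q(b_-)}$ (with positive real part); two charts are compatible if they give the same $\rho_Q$. A discrete Riemann surface $(\Sigma,\Lambda,z)$ is a bipartite quad-decomposition $\Lambda$ of a surface $\Sigma$ with an atlas $z$ of compatible charts $z_Q$, $Q\in F(\Lambda)$; it is compact if $\Sigma$ is. Medial graph $X$: its vertices are the midpoints of the edges of $\Lambda$; two of them are joined by an edge, denoted $[Q,v]$, if the corresponding edges of $\Lambda$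 belong to the same face $Q$ and share the vertex $v$. $X$ is a cellular decomposition of $\Sigma$ with faces $F_v$ ($v\in V(\Lambda)$; its vertices are the midpoints of the edges incident to $v$) and $F_Q$ ($Q\in F(\Lambda)$; its vertices are the midpoints of the four edges of $Q$). If the oriented edge $e=[Q,v]$ goes from the midpoint of $vv'_-$ to the midpoint of $vv'_+$, put $z_Q(e):=(z_Q(v'_+)-z_Q(v'_-))/2$. A discrete one-form $\omega$ is a complex function on the oriented edges of $X$ with $\omega(-e)=-\omega(e)$; write $\int_e\omega=\omega(e)$, extended additively to paths. It is of type $\Diamond$ if for each face $Q$ and its two black (or two white) vertices $v,v'$ one has $\omega([Q,v])=-\omega([Q,v'])$, both edges oriented as in $\partial F_Q$. On $\partial F_Q$, $dz_Q$ is the one-form with $\int_e dz_Q=z_Q(e)$. For $f:V(\Lambda)\to\mathbb{C}$, $df$ is the one-form of type $\Diamond$ with $\int_e df=(f(v'_+)-f(v'_-))/2$ for every oriented edge $e=[Q,v]$ of $X$ going from the midpoint of the edge $vv'_-$ to the midpoint of the edge $vv'_+$ of $\Lambda$. A discrete Abelian differential is a discrete one-form $\omega$ of type $\Diamond$. Its residue at $v\in V(\Lambda)$ is $\mathrm{res}_v(\omega)=\frac1{2\pi i}\oint_{\partial F_v}\omega$ (counterclockwise). $v$ is a simple pole of $\omega$ if $\mathrm{res}_v(\omega)\ne0$. $Q\in V(\Diamond)$ is a double pole of $\omega$ if $\omega|_{\partial F_Q}$ is not of the form $p\,dz_Q$ with $p\in\mathbb{C}$, and a zero of $\omega$ if $\omega|_{\partial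 F_Q}=0$. A divisor is a formal linear combination $D=\sum_{j=1}^M m_jv_j+\sum_{k=1}^N n_kQ_k$ with $v_j\in V(\Lambda)$, $m_j\in\{-1,0,1\}$, $Q_k\in V(\Diamond)$, $n_k\in\{-2,-1,0,1,2\}$ (distinct $v_j$, distinct $Q_k$). $D$ is admissible if $m_j\in\{-1,0\}$ and $n_k\in\{-2,0,1\}$ for all $j,k$. $\deg D:=\sum_j m_j+\sum_k\mathrm{sign}(n_k)$. $D\ge D'$ means that all coefficients of the formal sum $D-D'$ are nonnegative. Every $f:V(\Lambda)\to\mathbb{C}$ is called discrete meromorphic. It has a zero at $v\in V(\Lambda)$ if $f(v)=0$, a simple pole at $Q$ if $df$ has a double pole at $Q$, and a double value at $Q$ if $df|_{\partial F_Q}=0$. If $f$ has zeroes $v_1,\dots,v_M$, double values $Q_1,\dots,Q_N$ and poles $Q'_1,\dots,Q'_{N'}$, its divisor is $(f):=\sum_j v_j+\sum_k 2Q_k-\sum_{k'}Q'_{k'}$. If a discrete Abelian differential $\omega$ has zeroes $Q_1,\dots,Q_N$, double poles $Q'_1,\dots,Q'_{N'}$ and simple poles $v_1,\dots,v_M$, its divisor is $(\omega):=\sum_k Q_k-\sum_{k'}2Q'_{k'}-\sum_j v_j$. $L(D)$ is the complex vector space of discrete meromorphic functions $f$ that vanish identically or satisfy $(f)\ge D$, and $l(D):=\dim L(D)$. $H(D)$ is the complex vector space of discrete Abelian differentials $\omega$ with $\omega\equiv0$ or $(\omega)\ge D$, and $i(D):=\dim H(D)$. *)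

(* Defs.v *)
From HB Require Import structures.
From mathcomp Require Import all_boot all_order all_algebra all_fingroup.
From mathcomp Require Import boolp reals trigo.
From mathcomp Require Import complex.
From mathcomp Require classical_sets.

Set Implicit Arguments.
Unset Strict Implicit.
Unset Printing Implicit Defensive.

Import Order.TTheory GRing.Theory Num.Theory.
Local Open Scope set_scope.
Local Open Scope ring_scope.

(* A cellular decomposition of a closed oriented surface, encoded as a finite
   combinatorial map.  A dart is an oriented 1-cell; [opp] reverses it and
   [fnext] sends it to the next dart along the counterclockwise boundary of the
   2-cell on its left.  As the surface is oriented and has no boundary, darts
   are in bijection with the corners (Q, v) of the decomposition: the dart d is
   the corner of the face on its left at its origin. *)
Record cmap := CMap {
  dart :> finType;
  opp : {perm dart};
  fnext : {perm dart}
}.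

Section CombinatorialMap.

Variable M : cmap.
Implicit Types (d : M).

(* Counterclockwise rotation of the darts around their common origin: reverse
   the dart preceding d along the face on the left of d (products of
   permutations compose from left to right). *)
Definition vnext : {perm M} := ((fnext M)^-1 * opp M)%g.

(* A cell is the orbit of its darts: a vertex is the set of its outgoing darts,
   an edge is {d, opp d}, a face is the set of its boundary darts. *)
Definition vertex := {v : {set M} | v \in porbits vnext}.
Definition edge := {e : {set M} | e \in porbits (opp M)}.
Definition face := {Q : {set M} | Q \in porbits (fnext M)}.

Definition org d : vertex := exist _ (porbit vnext d) (imset_f _ isT).
Definition tgt d : vertex := org (opp M d).
Definition edge_of d : edge := exist _ (porbit (opp M) d) (imset_f _ isT).
Definition lface d : face := exist _ (porbit (fnext M) d) (imset_f _ isT).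

Definition ends (e : edge) : {set vertex} := [set org d | d in val e].
Definition fvertices (Q : face) : {set vertex} := [set org d | d in val Q].
Definition fedges (Q : face) : {set edge} := [set edge_of d | d in val Q].

Definition euler_char : int :=
  #|{: vertex}|%:Z - #|{: edge}|%:Z + #|{: face}|%:Z.

Definition has_genus (g : nat) : Prop := euler_char = 2 - 2 * g%:Z.

Definition strongly_regular : Prop :=
  forall Q Q' : face, Q != Q' ->
    [\/ fvertices Q :&: fvertices Q' = set0,
        (exists v, fvertices Q :&: fvertices Q' = [set v]) /\
          fedges Q :&: fedges Q' = set0
      | exists e, fedges Q :&: fedges Q' = [set e] /\
          fvertices Q :&: fvertices Q' = ends e].

(* Local finiteness is automatic since the set of darts is finite.
   [qd_embedded] says that the closed 2-cells are embedded quadrilaterals,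
   as the existence of the charts below requires. *)
Record quad_decomposition (black : pred vertex) : Prop := QuadDecomposition {
  qd_nonempty : (0 < #|M|)%N;
  qd_oppK : involutive (opp M);
  qd_opp_neq : forall d, opp M d != d;
  qd_connected : forall d d',
    connect [rel x y | (y == opp M x) || (y == fnext M x)] d d';
  qd_quad : forall Q : face, #|val Q| = 4;
  qd_embedded : forall Q : face, {in val Q &, injective org};
  qd_strongly_regular : strongly_regular;
  qd_bipartite : forall d, black (tgt d) = ~~ black (org d)
}.

(* Oriented edges of the medial graph.  The edge [Q, v] is given by the corner
   d of Q at v; it joins the midpoints of d and of [vnext d].  The orientation
   (d, true) is that of the counterclockwise boundary of F_Q, from the midpoint
   of [vnext d] to that of d; (d, false) is that of the counterclockwise
   boundary of F_v. *)
Definition medge : Type := (M * bool)%type.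
HB.instance Definition _ := Finite.on medge.

Definition mrev (e : medge) : medge := (e.1, ~~ e.2).
Definition mface (e : medge) : face := lface e.1.

(* The vertices v'_- and v'_+ such that e goes from the midpoint of v v'_- to
   the midpoint of v v'_+. *)
Definition vminus (e : medge) : vertex :=
  if e.2 then tgt (vnext e.1) else tgt e.1.
Definition vplus (e : medge) : vertex :=
  if e.2 then tgt e.1 else tgt (vnext e.1).

End CombinatorialMap.

Section Charts.

Variables (R : realType) (M : cmap).

Definition segment (p q x : R[i]) : Prop :=
  exists2 t : R, 0 <= t <= 1 & x = (1 - t)%:C%C * p + t%:C%C * q.

(* [z v] is the image of the vertex v of Q under the chart; values of z at
   vertices not in Q are irrelevant.  The three conditions say that the polygon
   with these successive vertices has no self-intersections and, through the
   shoelace formula, that it is positively oriented. *)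
Record is_chart (Q : face M) (z : vertex M -> R[i]) : Prop := IsChart {
  chart_adjacent : forall d, d \in val Q -> forall x,
    segment (z (org d)) (z (tgt d)) x ->
    segment (z (org (fnext M d))) (z (tgt (fnext M d))) x ->
    x = z (tgt d);
  chart_opposite : forall d, d \in val Q -> forall x,
    segment (z (org d)) (z (tgt d)) x ->
    ~ segment (z (org (fnext M (fnext M d)))) (z (tgt (fnext M (fnext M d)))) x;
  chart_oriented :
    0 < \sum_(d in val Q) complex.Im ((z (org d))^*%C * z (tgt d))
}.

End Charts.

(* One chart is chosen for each face: a compatible chart of Q differs from it by
   a constant factor on dz_Q, which changes neither poles nor zeroes below. *)
Record discrete_RS (R : realType) := DiscreteRS {
  qmap :> cmap;
  black : pred (vertex qmap);
  qmapP : quad_decomposition black;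
  chart : face qmap -> vertex qmap -> R[i];
  chartP : forall Q, is_chart Q (chart Q)
}.

(* The dimension of a linear subspace S of W; see [vdimP]. *)
Definition vdim (K : fieldType) (W : vectType K) (S : W -> Prop) : nat :=
  \dim (classical_sets.xget 0%VS
          (fun U : {vspace W} => forall x, x \in U <-> S x)).

Section Differentials.

Variables (R : realType) (S : discrete_RS R).
Local Notation C := (R[i]).
Local Notation V := (vertex S).
Local Notation F := (face S).
Implicit Types (f : {ffun V -> C^o}) (w : {ffun medge S -> C^o}).

Definition one_form w : Prop := forall e, w (mrev e) = - w e.

Definition type_diamond w : Prop :=
  forall d d' : S, lface d = lface d' -> d != d' ->
    black (org d) = black (org d') -> w (d, true) = - w (d', true).

Definition abelian_differential w : Prop := one_form w /\ type_diamond w.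

Definition dz (e : medge S) : C :=
  (chart (mface e) (vplus e) - chart (mface e) (vminus e)) / 2.

Definition df f : {ffun medge S -> C^o} :=
  [ffun e => (f (vplus e) - f (vminus e)) / 2].

Definition res w (v : V) : C :=
  (2 * (pi : R)%:C%C * 'i%C)^-1 * \sum_(d in val v) w (d, false).

Definition simple_pole w (v : V) : bool := res w v != 0.

Definition double_pole w (Q : F) : bool :=
  `[< ~ exists p : C, forall d, d \in val Q -> w (d, true) = p * dz (d, true) >].

Definition form_zero w (Q : F) : bool := [forall d in val Q, w (d, true) == 0].

(* Formal linear combinations of vertices (inl) and faces (inr). *)
Definition formal_sum : zmodType := {ffun V + F -> int}.
Implicit Types D : formal_sum.

Definition is_divisor D : Prop :=
  (forall v : V, D (inl v) \in [:: -1; 0; 1]) /\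
  (forall Q : F, D (inr Q) \in [:: -2; -1; 0; 1; 2]).

Definition admissible D : Prop :=
  [/\ is_divisor D,
      forall v : V, D (inl v) \in [:: -1; 0] &
      forall Q : F, D (inr Q) \in [:: -2; 0; 1]].

Definition deg D : int :=
  \sum_(v : V) D (inl v) + \sum_(Q : F) Num.sg (D (inr Q)).

Definition div_ge D D' : Prop := forall x, 0 <= (D - D') x.

Definition div_fun f : formal_sum :=
  [ffun x => match x with
             | inl v => (f v == 0)%:Z
             | inr Q => 2 * (form_zero (df f) Q)%:Z - (double_pole (df f) Q)%:Z
             end].

Definition div_form w : formal_sum :=
  [ffun x => match x with
             | inl v => - (simple_pole w v)%:Z
             | inr Q => (form_zero w Q)%:Z - 2 * (double_pole w Q)%:Z
             end].

Definition L D f : Prop := f = 0 \/ div_ge (div_fun f) D.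

Definition H D w : Prop :=
  abelian_differential w /\ (w = 0 \/ div_ge (div_form w) D).

Definition l D : nat := vdim (L D).
Definition i D : nat := vdim (H D).

End Differentials.

Lemma vdimP (K : fieldType) (W : vectType K) (S : W -> Prop) :
  S 0 -> (forall (a : K) x y, S x -> S y -> S (a *: x + y)) ->
  exists2 U : {vspace W}, (forall x, x \in U <-> S x) & vdim S = \dim U.
Proof.
move=> S0 Slin.
have [U hU] : exists U : {vspace W}, forall x, x \in U <-> S x.
  pose P n := `[< exists2 U : {vspace W}, (forall x, x \in U -> S x) &
                                        \dim U = n >].
  have exP : exists n, P n.
    exists 0%N; apply/asboolP; exists 0%VS; last by rewrite dimv0.
    by move=> x; rewrite memv0 => /eqP ->.
  have ubP n : P n -> (n <= \dim {:W})%N.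
    by move=> /asboolP[U _ <-]; rewrite dimvS // subvf.
  case: (ex_maxnP exP ubP) => n /asboolP[U US dU] maxn.
  exists U => x; split=> [/US //|Sx].
  have /maxn : P (\dim (<[x]> + U)%VS).
    apply/asboolP; exists (<[x]> + U)%VS => // y /memv_addP[u /vlineP[a ->]].
    by move=> [t tU ->]; apply: Slin => //; apply: US.
  rewrite -dU => le_dim.
  have /eqP -> : (U == <[x]> + U)%VS by rewrite eqEdim addvSr.
  by rewrite (subvP (addvSl _ _)) ?memv_line.
exists U => //; rewrite /vdim; case: classical_sets.xgetP => [U' _ hU'|/(_ U)//].
by congr (\dim _); apply/vspaceP => x; apply/idP/idP => [/(hU' x)/hU|/hU/(hU' x)].
Qed.

Section Subspaces.

Variables (R : realType) (S : discrete_RS R).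
Implicit Types (D : formal_sum S) (Q : face S).

Lemma form_zeroP (w : {ffun medge S -> R[i]^o}) Q :
  reflect (forall d, d \in val Q -> w (d, true) = 0) (form_zero w Q).
Proof.
apply: (iffP forall_inP) => hw d dQ; first exact/eqP/hw.
by rewrite hw.
Qed.

Lemma no_double_poleP (w : {ffun medge S -> R[i]^o}) Q :
  ~~ double_pole w Q <->
  exists p : R[i], forall d, d \in val Q -> w (d, true) = p * dz (d, true).
Proof.
rewrite /double_pole; split=> [|hp]; last by apply/negP => /asboolP.
by move=> /asboolPn; apply: contra_notP.
Qed.

Lemma zero_no_double_pole (w : {ffun medge S -> R[i]^o}) Q :
  form_zero w Q -> ~~ double_pole w Q.
Proof.
move=> /form_zeroP w0; apply/no_double_poleP; exists 0 => d dQ.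
by rewrite mul0r w0.
Qed.

Lemma form_zero_lin a (w w' : {ffun medge S -> R[i]^o}) Q :
  form_zero w Q -> form_zero w' Q -> form_zero (a *: w + w') Q.
Proof.
move=> /form_zeroP h /form_zeroP h'; apply/form_zeroP => d dQ.
by rewrite !ffunE h // h' // addr0; exact: mulr0.
Qed.

Lemma double_pole_lin a (w w' : {ffun medge S -> R[i]^o}) Q :
  ~~ double_pole w Q -> ~~ double_pole w' Q -> ~~ double_pole (a *: w + w') Q.
Proof.
move=> /no_double_poleP[p h] /no_double_poleP[p' h']; apply/no_double_poleP.
exists (a * p + p') => d dQ.
by rewrite !ffunE h // h' // mulrDl -mulrA.
Qed.

Lemma res_lin a (w w' : {ffun medge S -> R[i]^o}) v :
  res (a *: w + w') v = a * res w v + res w' v.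
Proof.
rewrite /res mulrCA -mulrDr; congr (_ * _); rewrite mulr_sumr -big_split /=.
by apply: eq_bigr => d _; rewrite !ffunE.
Qed.

Lemma df_lin a (f h : {ffun vertex S -> R[i]^o}) :
  df (a *: f + h) = a *: df f + df h.
Proof.
apply/ffunP => e; rewrite !ffunE opprD addrACA mulrDl; congr (_ + _).
by rewrite -scalerBr -scalerAl.
Qed.

(* [L D] and [H D] are linear subspaces, so that [l D] and [i D] are their
   dimensions for every D. *)
Lemma L_subspace D :
  L D 0 /\ (forall a f h, L D f -> L D h -> L D (a *: f + h)).
Proof.
split; first by left.
have df0 : df (0 : {ffun vertex S -> R[i]^o}) = 0.
  by apply/ffunP => e; rewrite !ffunE subrr mul0r.
have top f x : div_fun f x <= div_fun (0 : {ffun vertex S -> R[i]^o}) x.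
  rewrite !ffunE df0; case: x => [v|Q]; first by rewrite !ffunE eqxx; case: eqP.
  have z0 : form_zero (0 : {ffun medge S -> R[i]^o}) Q.
    by apply/form_zeroP => d _; rewrite ffunE.
  rewrite z0 (negbTE (zero_no_double_pole z0)).
  by case: (form_zero _ _); case: (double_pole _ _).
have lin (a : R[i]) (f h : {ffun vertex S -> R[i]^o}) (x : vertex S + face S)
    (c : int) :
    c <= div_fun f x -> c <= div_fun h x -> c <= div_fun (a *: f + h) x.
  rewrite !(ffunE _ x); case: x => [v|Q]; rewrite ?df_lin.
    have [f0|f0] := eqVneq (f v) 0; have [h0|h0] := eqVneq (h v) 0; last 3 first.
    - by move=> _ h1; apply: le_trans h1 _; case: eqP.
    - by move=> h1 _; apply: le_trans h1 _; case: eqP.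
    - by move=> h1 _; apply: le_trans h1 _; case: eqP.
    by rewrite !ffunE f0 h0 scaler0 addr0 eqxx.
  have Z := @form_zero_lin a (df f) (df h) Q.
  have P := @double_pole_lin a (df f) (df h) Q.
  have Zf := @zero_no_double_pole (df f) Q.
  have Zh := @zero_no_double_pole (df h) Q.
  have Zn := @zero_no_double_pole (a *: df f + df h) Q.
  move: Z P Zf Zh Zn.
  case: (form_zero (df f) Q); case: (double_pole (df f) Q);
  case: (form_zero (df h) Q); case: (double_pole (df h) Q);
  case: (form_zero _ Q); case: (double_pole _ Q) => Z P Zf Zh Zn hc hc';
  first [by apply: le_trans hc _ | by apply: le_trans hc' _ | by move: (Z isT isT)
    | by move: (P isT isT) | by move: (Zf isT) | by move: (Zh isT)
    | by move: (Zn isT)].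
move=> a f h Lf Lh.
have ge u : L D u -> u = 0 \/ forall x, D x <= div_fun u x.
  by case=> [|hu]; [left|right => x; have := hu x; rewrite !ffunE subr_ge0].
have le u : (forall x, D x <= div_fun u x) -> L D u.
  by move=> hu; right => x; have := hu x; rewrite !ffunE subr_ge0.
case: (ge _ Lf) => [->|hf]; first by rewrite scaler0 add0r.
apply: le => x; apply: lin; first exact: hf.
by case: (ge _ Lh) => [->|//]; apply: le_trans (hf x) (top _ _).
Qed.

Lemma H_subspace D :
  H D 0 /\ (forall a w w', H D w -> H D w' -> H D (a *: w + w')).
Proof.
have ad0 : abelian_differential (0 : {ffun medge S -> R[i]^o}).
  by split=> [e|d d' _ _ _]; rewrite !ffunE oppr0.
split; first by split; [|left].
have top w x : div_form w x <= div_form (0 : {ffun medge S -> R[i]^o}) x.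
  rewrite !ffunE; case: x => [v|Q].
    rewrite /simple_pole [res 0 v]/res big1 ?mulr0 ?eqxx; last first.
      by move=> d _; rewrite ffunE.
    by case: eqP.
  have z0 : form_zero (0 : {ffun medge S -> R[i]^o}) Q.
    by apply/form_zeroP => d _; rewrite ffunE.
  rewrite z0 (negbTE (zero_no_double_pole z0)).
  by case: (form_zero _ _); case: (double_pole _ _).
have lin (a : R[i]) (w w' : {ffun medge S -> R[i]^o}) (x : vertex S + face S)
    (c : int) :
    c <= div_form w x -> c <= div_form w' x -> c <= div_form (a *: w + w') x.
  rewrite !ffunE; case: x => [v|Q].
    rewrite /simple_pole res_lin.
    have [f0|f0] := eqVneq (res w v) 0; have [h0|h0] := eqVneq (res w' v) 0;
      last 3 first.
    - by move=> _ h1; apply: le_trans h1 _; case: eqP.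
    - by move=> h1 _; apply: le_trans h1 _; case: eqP.
    - by move=> h1 _; apply: le_trans h1 _; case: eqP.
    by rewrite f0 h0 addr0 mulr0 eqxx.
  have Z := @form_zero_lin a w w' Q.
  have P := @double_pole_lin a w w' Q.
  have Zf := @zero_no_double_pole w Q.
  have Zh := @zero_no_double_pole w' Q.
  have Zn := @zero_no_double_pole (a *: w + w') Q.
  move: Z P Zf Zh Zn.
  case: (form_zero w Q); case: (double_pole w Q);
  case: (form_zero w' Q); case: (double_pole w' Q);
  case: (form_zero _ Q); case: (double_pole _ Q) => Z P Zf Zh Zn hc hc';
  first [by apply: le_trans hc _ | by apply: le_trans hc' _ | by move: (Z isT isT)
    | by move: (P isT isT) | by move: (Zf isT) | by move: (Zh isT)
    | by move: (Zn isT)].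
move=> a w w' [[w1 w2] Lf] [[w1' w2'] Lh]; split.
  split=> [e|d d' Qd nd bd]; rewrite !ffunE.
    by rewrite w1 w1' scalerN opprD.
  by rewrite (w2 _ _ Qd nd bd) (w2' _ _ Qd nd bd) scalerN opprD.
have ge u : u = 0 \/ div_ge (div_form u) D ->
    u = 0 \/ forall x, D x <= div_form u x.
  by case=> [|hu]; [left|right => x; have := hu x; rewrite !ffunE subr_ge0].
have le u : (forall x, D x <= div_form u x) -> u = 0 \/ div_ge (div_form u) D.
  by move=> hu; right => x; have := hu x; rewrite !ffunE subr_ge0.
case: (ge _ Lf) => [->|hf]; first by rewrite scaler0 add0r.
apply: le => x; apply: lin; first exact: hf.
by case: (ge _ Lh) => [->|//]; apply: le_trans (hf x) (top _ _).
Qed.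

End Subspaces.

(* Main.v *)
(* For a function f and a form w of type diamond, put
   <f, w> = sum_d f(org d) w(d, true).  Grouping the corners d by vertices, this
   is -2 pi i times the sum of the f(v) res_v(w); grouping them by faces, it is
   the sum over Q of a nondegenerate alternating pairing between df and w on the
   boundary of F_Q.  Restrict it to the functions f that vanish where
   D(v) = -1 and to the forms w that have no double pole where D(Q) = 0 and
   vanish where D(Q) = 1.  As dz_Q spans its own orthogonal, the left kernel of
   this restriction is L(-D) and its right kernel is H(D).  Both kernels have
   the same codimension, so l(-D) - i(D) is the difference
   (#V + sum_v D(v)) - (#F - sum_Q sign D(Q)) of the dimensions of the two
   spaces, and Euler's formula gives #V - #F = 2 - 2g since all faces are
   quadrilaterals. *)
From HB Require Import structures.
From mathcomp Require Import all_boot all_order all_algebra all_fingroup.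
From mathcomp Require Import reals complex.
From mathcomp Require Import ring.
Require Import Defs.

Set Implicit Arguments.
Unset Strict Implicit.
Unset Printing Implicit Defensive.

Import Order.TTheory GRing.Theory Num.Theory.
Local Open Scope ring_scope.

(** * Dimensions of subspaces from parametrisations and matrix ranks *)

Lemma vdim_param (K : fieldType) (W : vectType K) (T : W -> Prop) (k : nat)
    (psi : {linear 'rV[K]_k -> W}) :
    T 0 -> (forall (a : K) x y, T x -> T y -> T (a *: x + y)) ->
    injective psi -> (forall w, T w <-> exists u, w = psi u) ->
  vdim T = k.
Proof.
move=> T0 Tlin psi_inj TP; have [U UP ->] := vdimP T0 Tlin.
have -> : U = limg (linfun psi).
  apply/vspaceP => w; apply/idP/memv_imgP => [/UP/TP[u ->]|[u _ ->]].
    by exists u; rewrite ?memvf // lfunE.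
  by apply/UP/TP; exists u; rewrite lfunE.
rewrite limg_dim_eq; first by rewrite dimvf /dim /= mul1n.
apply/eqP; rewrite capfv; apply/lker0P => u u'; rewrite !lfunE; exact: psi_inj.
Qed.

(** The rows of [N] are a basis of the left kernel of [B], so multiplication by [N] followed by
    [phi] parametrises [T] injectively. *)
Lemma vdim_kermx (K : fieldType) (W : vectType K) (T : W -> Prop) (m n : nat)
    (B : 'M[K]_(m, n)) (phi : {linear 'rV[K]_m -> W}) :
    T 0 -> (forall (a : K) x y, T x -> T y -> T (a *: x + y)) ->
    injective phi ->
    (forall w, T w <-> exists2 u, u *m B = 0 & w = phi u) ->
  vdim T = (m - \rank B)%N.
Proof.
move=> T0 Tlin phi_inj TP; rewrite -mxrank_ker.
pose N := row_base (kermx B).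
apply: (@vdim_param _ _ _ _ (phi \o mulmxr N)) => //.
  move=> u u' /phi_inj /=; exact: (row_free_inj (row_base_free _)).
move=> w; split=> [/TP[u uB ->]|[u ->]].
  have /submxP[u' ->] : (u <= N)%MS by rewrite eq_row_base; apply/sub_kermxP.
  by exists u'.
apply/TP; exists (u *m N) => //.
by apply/sub_kermxP; rewrite (submx_trans (submxMl _ _)) ?eq_row_base.
Qed.

(** Serves both sides of the duality: with functions indexed by [I] and forms by [J], and with the
    two exchanged. [P] selects the coordinates that may be nonzero, [Q] the equations that are
    imposed. *)
Lemma vdim_kernel (K : fieldType) (W : vectType K) (T : W -> Prop)
    (I J : finType) (P : {set I}) (Q : {set J}) (B : I -> J -> K) (e : I -> W) :
    T 0 -> (forall (a : K) x y, T x -> T y -> T (a *: x + y)) ->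
    (forall x : I -> K, \sum_i x i *: e i = 0 -> forall i, x i = 0) ->
    (forall w, T w <-> exists x : I -> K,
       [/\ forall i, i \notin P -> x i = 0,
           forall j, j \in Q -> \sum_i x i * B i j = 0 &
           w = \sum_i x i *: e i]) ->
  vdim T = (#|P| - \rank (\matrix_(i < #|P|, j < #|Q|)
                            B (enum_val i) (enum_val j)))%N.
Proof.
move=> T0 Tlin e_free TP.
pose phi (u : 'rV[K]_#|P|) := \sum_i u 0 i *: e (enum_val i).
have phi_lin : linear phi.
  move=> a u u'; rewrite /phi scaler_sumr -big_split /=; apply: eq_bigr => i _.
  by rewrite !mxE scalerDl scalerA.
pose phiM := GRing.isLinear.Build _ _ _ _ _ phi_lin.
pose phiL : {linear 'rV[K]_#|P| -> W} := HB.pack phi phiM.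
(* Extension of a row vector by zero outside [P]; at most one term of the sum is nonzero. *)
pose ext (u : 'rV[K]_#|P|) i := \sum_k u 0 k *+ (enum_val k == i).
have ext_val u k : ext u (enum_val k) = u 0 k.
  rewrite /ext (bigD1 k) //= eqxx big1 ?addr0 // => k' /negPf nk.
  by rewrite (inj_eq enum_val_inj) nk.
have ext_off u i : i \notin P -> ext u i = 0.
  move=> iP; rewrite /ext big1 // => k _; case: eqP => // ki.
  by rewrite -ki enum_valP in iP.
have sum_on (V : lmodType K) x (F : I -> V) : (forall i, i \notin P -> x i = 0) ->
    \sum_i x i *: F i = \sum_(k < #|P|) x (enum_val k) *: F (enum_val k).
  move=> xP; rewrite -(big_enum_val (fun i => x i *: F i)) [RHS]big_mkcond.
  by apply: eq_bigr => i _; case: ifPn => // /xP ->; rewrite scale0r.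
have phi_ext u : phi u = \sum_i ext u i *: e i.
  rewrite sum_on; last exact: ext_off.
  by apply: eq_bigr => k _; rewrite ext_val.
apply: (@vdim_kermx _ _ _ _ _ _ phiL) => //.
  move=> u u' /eqP; rewrite -subr_eq0 -linearB /= phi_ext => /eqP/e_free u0.
  apply/eqP; rewrite -subr_eq0; apply/eqP/rowP => k.
  by rewrite -ext_val u0 mxE.
move=> w; split=> [/TP[x [xP xQ ->]]|[u uB ->]].
  exists (\row_k x (enum_val k)); last first.
    by rewrite /= /phi sum_on //; apply: eq_bigr => k _; rewrite mxE.
  apply/rowP => j; rewrite !mxE -[RHS](xQ (enum_val j)) ?enum_valP //.
  rewrite (@sum_on K^o x (fun i => B i _)) //.
  by apply: eq_bigr => k _; rewrite !mxE.
apply/TP; exists (ext u); split=> [i /ext_off -> //|j jQ|]; last exact: phi_ext.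
rewrite (@sum_on K^o (ext u) (fun i => B i _)); last exact: ext_off.
have /rowP/(_ (enum_rank_in jQ j)) := uB; rewrite !mxE => uBj.
by rewrite -[RHS]uBj; apply: eq_bigr => k _; rewrite ext_val !mxE enum_rankK_in.
Qed.

(** * Cells as orbits of darts *)

Section Cells.

Variables (T : finType) (s : {perm T}).
Local Notation cell := {A : {set T} | A \in porbits s}.

Lemma mem_cell (A : cell) x : (x \in val A) = (porbit s x == val A).
Proof.
case: A => A /= /imsetP[y _ ->].
by rewrite eq_porbit_mem.
Qed.

Lemma sum_cells (V : nmodType) (F : T -> V) :
  \sum_(A : cell) \sum_(x in val A) F x = \sum_x F x.
Proof.
pose c x : cell := exist _ (porbit s x) (imset_f _ isT).
rewrite [RHS](partition_big c xpredT) //=; apply: eq_bigr => A _.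
by apply: eq_bigl => x; rewrite mem_cell.
Qed.

Lemma card_cells k : (forall A : cell, #|val A| = k) -> #|T| = (k * #|{: cell}|)%N.
Proof.
move=> cellk; rewrite -sum1_card -(@sum_cells nat) mulnC -sum_nat_const.
by apply: eq_bigr => A _; rewrite sum1_card.
Qed.

End Cells.

(** * Combinatorics of quadrilateral faces *)

Section Quadrilaterals.

Variables (M : cmap) (black : pred (vertex M)).
Hypothesis MP : quad_decomposition black.
Implicit Types d : M.
Local Notation fn := (fnext M).

Lemma mem_vertex (v : vertex M) d : (d \in val v) = (org d == v).
Proof. exact: mem_cell. Qed.

Lemma mem_face (Q : face M) d : (d \in val Q) = (lface d == Q).
Proof. exact: mem_cell. Qed.

Lemma ex_dart (Q : face M) : exists d, lface d = Q.
Proof. by case: Q => Q QP; have /imsetP[d _ Qd] := QP; exists d; apply: val_inj. Qed.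

Lemma org_vnext d : org (vnext M d) = org d.
Proof. by apply: val_inj; exact: (porbit_perm _ 1). Qed.

Lemma lface_fnext d : lface (fn d) = lface d.
Proof. by apply: val_inj; exact: (porbit_perm _ 1). Qed.

Lemma vnextE d : vnext M d = opp M ((fn^-1)%g d).
Proof. by rewrite permM. Qed.

Lemma org_fnext d : org (fn d) = tgt d.
Proof. by rewrite -org_vnext vnextE permK. Qed.

Lemma fnext4 d : fn (fn (fn (fn d))) = d.
Proof.
by have := iter_porbit fn d; have /= -> := qd_quad MP (lface d).
Qed.

Lemma mem_lface d : val (lface d) =i [:: d; fn d; fn (fn d); fn (fn (fn d))].
Proof.
move=> d'; rewrite /= porbit_traject.
by have /= -> := qd_quad MP (lface d).
Qed.

Lemma uniq_face d : uniq [:: d; fn d; fn (fn d); fn (fn (fn d))].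
Proof.
by have := uniq_traject_porbit fn d; have /= -> := qd_quad MP (lface d).
Qed.

Lemma sum_lface (V : nmodType) d (F : M -> V) :
  \sum_(d' in val (lface d)) F d' =
  F d + (F (fn d) + (F (fn (fn d)) + F (fn (fn (fn d))))).
Proof.
rewrite (eq_bigl _ _ (mem_lface d)) -big_uniq ?uniq_face //=.
by rewrite !big_cons big_nil addr0.
Qed.

Lemma tgt_vnext d : tgt (vnext M d) = org (fn (fn (fn d))).
Proof.
by rewrite vnextE /tgt (qd_oppK MP) -{1}[d]fnext4 permK.
Qed.

Lemma black_fnext d : black (org (fn d)) = ~~ black (org d).
Proof. by rewrite org_fnext (qd_bipartite MP). Qed.

(** Colours alternate along the boundary of a face, which leaves only the opposite corner. *)
Lemma same_color_opposite d d' :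
    lface d = lface d' -> d != d' -> black (org d) = black (org d') ->
  d' = fn (fn d).
Proof.
move=> Qd nd; have : d' \in val (lface d) by rewrite mem_face Qd.
rewrite mem_lface !inE (eq_sym d') (negPf nd) /=.
by case/or3P=> /eqP-> //; rewrite !black_fnext ?negbK; case: black.
Qed.

(** Counting darts by faces and by edges gives 4 #F = 2 #E, hence #E = 2 #F. *)
Lemma euler_char_quad : euler_char M = #|{: vertex M}|%:Z - #|{: face M}|%:Z.
Proof.
have E4 : #|M| = (4 * #|{: face M}|)%N := card_cells (qd_quad MP).
have E2 : #|M| = (2 * #|{: edge M}|)%N.
  apply: card_cells => -[A /= /imsetP[d _ ->]].
  have -> : porbit (opp M) d = [set d; opp M d]; last first.
    by rewrite cards2 eq_sym (qd_opp_neq MP).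
  apply/setP => d'; rewrite !inE; apply/porbitP/orP.
    case=> k ->; elim: k => [|k [] /eqP IHk]; first by rewrite perm1 eqxx; left.
      by rewrite expgSr permM IHk eqxx; right.
    by rewrite expgSr permM IHk (qd_oppK MP) eqxx; left.
  by case=> /eqP->; [exists 0; rewrite perm1 | exists 1; rewrite expg1].
have : (4 * #|{: face M}| = 2 * #|{: edge M}|)%N by rewrite -E4.
rewrite /euler_char -(mulnA 2 2) => /eqP; rewrite eqn_mul2l /= => /eqP <-.
by rewrite mul2n -addnn PoszD; ring.
Qed.

End Quadrilaterals.

(** * Forms of type diamond on a single face *)

Section FaceBasis.

Variables (R : realType) (S : discrete_RS R).
Local Notation C := (R[i]).
Local Notation V := (vertex S).
Local Notation F := (face S).
Local Notation fn := (fnext S).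
Local Notation SP := (qmapP S).
Implicit Types (f : {ffun V -> C^o}) (w : {ffun medge S -> C^o}).
Implicit Types (d : S) (Q : F) (b : bool) (D : formal_sum S).

(** Type diamond restated by the half-turn of each face, since the corners of equal colour are [d]
    and [fn (fn d)]. *)
Definition opposite_odd (h : S -> C) : Prop := forall d, h (fn (fn d)) = - h d.

Lemma abelian_opposite w :
  abelian_differential w -> opposite_odd (fun d => w (d, true)).
Proof.
move=> [_ wT] d; rewrite (wT d (fn (fn d))) ?opprK //.
- by rewrite !lface_fnext.
- by have := uniq_face SP d; rewrite /= !inE !negb_or => /andP[/and3P[]].
- by rewrite !(black_fnext SP) negbK.
Qed.

Lemma opposite_abelian w :
    one_form w -> opposite_odd (fun d => w (d, true)) ->
  abelian_differential w.
Proof.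
move=> w1 wopp; split=> // d d' Qd nd bd.
by rewrite (same_color_opposite SP Qd nd bd) wopp opprK.
Qed.

Lemma dfE f d : df f (d, true) = (f (org (fn d)) - f (org (fn (fn (fn d))))) / 2.
Proof. by rewrite ffunE /vplus /vminus /= org_fnext (tgt_vnext SP). Qed.

Lemma df_abelian f : abelian_differential (df f).
Proof.
apply: opposite_abelian => [[d b]|d].
  by rewrite !ffunE /vplus /vminus; case: b => /=; rewrite -mulNr opprB.
by rewrite !dfE (fnext4 SP) -mulNr opprB.
Qed.

Lemma dzE d : dz (d, true) =
  (chart (lface d) (org (fn d)) - chart (lface d) (org (fn (fn (fn d))))) / 2.
Proof. by rewrite /dz /vplus /vminus /= org_fnext (tgt_vnext SP). Qed.

Lemma dz_opposite : opposite_odd (fun d => dz (d, true)).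
Proof.
by move=> d; rewrite !dzE !lface_fnext (fnext4 SP) -mulNr opprB.
Qed.

(* If [dz] vanished on Q, opposite vertices of the chart would coincide, which
   forces zero area. *)
Lemma dz_neq0 Q : exists2 d, d \in val Q & dz (d, true) != 0.
Proof.
apply/exists_inP; apply: contraT; rewrite negb_exists_in => /forall_inP dz0.
have [d Qd] := ex_dart Q; have chQ := chart_oriented (chartP Q).
have z0 d' : d' \in val Q -> chart Q (org (fn d')) = chart Q (org (fn (fn (fn d')))).
  move=> d'Q; move: (dz0 _ d'Q); rewrite negbK dzE.
  move: d'Q; rewrite mem_face => /eqP ->.
  by rewrite mulf_eq0 invr_eq0 pnatr_eq0 orbF subr_eq0 => /eqP.
have dQ : d \in val Q by rewrite mem_face Qd.
have z13 := z0 _ dQ.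
have := z0 (fn d); rewrite mem_face lface_fnext -mem_face => /(_ dQ) z20.
move: chQ; rewrite -Qd (sum_lface SP) -!org_fnext (fnext4 SP) Qd.
move: z20 z13; rewrite (fnext4 SP) => -> ->.
case: (chart Q _) => a b; case: (chart Q _) => a' b' /=.
by rewrite (_ : _ + _ = 0) ?ltxx //; ring.
Qed.

(* On each face [eta true], [eta false] is an orthogonal basis of the two
   dimensional space of forms of type diamond, for the Hermitian product
   [sum_(d in Q) w(d) * (w' d)^*]. *)
Definition eta b d : C :=
  if b then dz (d, true) else - (dz (fn d, true))^*.

Lemma eta_opposite b : opposite_odd (eta b).
Proof.
by case: b => d; rewrite /eta ?dz_opposite // rmorphN.
Qed.

(** The squared norm of [eta true] on Q, and also that of [eta false], because [fn] permutes the
    corners of Q. *)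
Definition sqnorm Q : C := \sum_(d in val Q) `|dz (d, true)| ^+ 2.

Lemma sqnorm_neq0 Q : sqnorm Q != 0.
Proof.
have [d dQ zd] := dz_neq0 Q.
rewrite /sqnorm psumr_neq0 => [|d' _]; last by rewrite exprn_ge0.
by apply/hasP; exists d; rewrite ?mem_index_enum // dQ exprn_gt0 // normr_gt0.
Qed.

Lemma sqnormE d :
  sqnorm (lface d) =
  2 * (dz (d, true) * (dz (d, true))^* + dz (fn d, true) * (dz (fn d, true))^*).
Proof.
rewrite /sqnorm (sum_lface SP) !dz_opposite !normrN !normCK.
by ring.
Qed.

Definition coef b w Q : C :=
  (\sum_(d in val Q) w (d, true) * (eta b d)^*) / sqnorm Q.

Lemma coefE b w d : opposite_odd (fun d => w (d, true)) ->
  coef b w (lface d) = 2 * (w (d, true) * (eta b d)^* +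
    w (fn d, true) * (eta b (fn d))^*) / sqnorm (lface d).
Proof.
move=> w_odd; congr (_ / _).
rewrite (sum_lface SP) !w_odd !eta_opposite !rmorphN; ring.
Qed.

Lemma eta_expansion w d : opposite_odd (fun d => w (d, true)) ->
  w (d, true) = coef true w (lface d) * eta true d
              + coef false w (lface d) * eta false d.
Proof.
move=> w_odd; have := sqnorm_neq0 (lface d).
rewrite !coefE // sqnormE /eta !dz_opposite !rmorphN /= !conjCK 
  mulf_eq0 negb_or => /andP[_ N0].
by field; exact: N0.
Qed.

Lemma coef_eta0 b w p Q :
  (forall d, d \in val Q -> w (d, true) = p * eta (~~ b) d) -> coef b w Q = 0.
Proof.
move=> wQ; rewrite /coef (eq_bigr (fun d => p * eta (~~ b) d * (eta b d)^*)).
  have [d <-] := ex_dart Q; rewrite (sum_lface SP) !eta_opposite !rmorphN.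
  rewrite (_ : _ + _ = 0) ?mul0r //.
  by case: b {wQ}; rewrite /eta /= !dz_opposite !rmorphN /= ?conjCK; ring.
by move=> d /wQ ->.
Qed.

(** Since [eta true] is dz_Q, a double pole is exactly a nonzero component along [eta false]. *)
Lemma no_double_pole_coef w Q : abelian_differential w ->
  ~~ double_pole w Q <-> coef false w Q = 0.
Proof.
move=> /abelian_opposite w_odd; rewrite no_double_poleP; split=> [[p wQ]|w0].
  exact: (@coef_eta0 false _ p).
exists (coef true w Q) => d; rewrite mem_face => /eqP Qd.
by rewrite (eta_expansion d w_odd) Qd w0 mul0r addr0.
Qed.

Lemma form_zero_coef w Q : abelian_differential w ->
  form_zero w Q <-> coef true w Q = 0 /\ coef false w Q = 0.
Proof.
move=> /abelian_opposite w_odd; split=> [/form_zeroP w0|[wt wf]].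
  by split; apply: (@coef_eta0 _ _ 0) => d /w0 ->; rewrite mul0r.
apply/form_zeroP => d; rewrite mem_face => /eqP Qd.
by rewrite (eta_expansion d w_odd) Qd wt wf !mul0r addr0.
Qed.

(** Summation by parts around Q moves the difference from f to [eta]; a step by [fn] followed by
    conjugation exchanges the two basis forms up to sign. So the component of df along one basis
    form is, up to a nonzero factor, the pairing of f with the other: dz_Q is its own orthogonal. *)
Lemma coef_df b f Q :
  coef (~~ b) (df f) Q =
  (-1) ^+ b * (\sum_(d in val Q) f (org d) * eta b d) / sqnorm Q.
Proof.
congr (_ / _); have [d <-] := ex_dart Q.
rewrite !(sum_lface SP) !dfE !eta_opposite !(fnext4 SP).
by case: b; rewrite /eta /= ?expr1 ?expr0 !dz_opposite !rmorphN /= ?conjCK; field.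
Qed.

Lemma coef_unique w (x : bool -> C) Q :
    (forall d, d \in val Q ->
       w (d, true) = x true * eta true d + x false * eta false d) ->
  forall b, coef b w Q = x b.
Proof.
move=> wQ b; apply: (canLR (mulfK (sqnorm_neq0 Q))).
pose wE d := (x true * eta true d + x false * eta false d) * (eta b d)^*.
rewrite (eq_bigr wE) => [|d /wQ -> //]; have [d <-] := ex_dart Q.
rewrite sqnormE (sum_lface SP) /wE !eta_opposite !rmorphN /=.
by case: b {wE}; rewrite /eta /= ?dz_opposite ?rmorphN /= ?conjCK; ring.
Qed.

(** * A basis of the space of Abelian differentials *)

Definition eta_form (y : F * bool) : {ffun medge S -> C^o} :=
  [ffun e => if mface e == y.1 then (if e.2 then 1 else -1) * eta y.2 e.1 else 0].

Lemma sum_eta_form (x : F * bool -> C) d :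
  (\sum_y x y *: eta_form y) (d, true) =
  x (lface d, true) * eta true d + x (lface d, false) * eta false d.
Proof.
rewrite sum_ffunE.
transitivity (\sum_Q \sum_b (x (Q, b) *: eta_form (Q, b)) (d, true)).
  by rewrite pair_bigA; apply: eq_bigr => -[].
rewrite (bigD1 (lface d)) //= [X in _ + X]big1 ?addr0 => [|Q nQ].
  by rewrite big_bool /= !ffunE /= eqxx !mul1r.
rewrite big1 // => b _; rewrite !ffunE /mface /= eq_sym (negPf nQ).
exact: mulr0.
Qed.

Lemma sum_eta_form_abelian (x : F * bool -> C) :
  abelian_differential (\sum_y x y *: eta_form y).
Proof.
apply: opposite_abelian => [[d b]|d].
  rewrite !sum_ffunE -sumrN; apply: eq_bigr => y _.
  rewrite !ffunE /mface /= -scalerN; congr (_ *: _).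
  by case: eqP; rewrite ?oppr0 //; case: b; rewrite /= ?mulN1r ?mul1r ?opprK.
by rewrite !sum_eta_form !lface_fnext !eta_opposite; ring.
Qed.

(** Yields the linear independence of the [eta_form y]; spanning is [abelian_eta_form]. *)
Lemma coef_sum_eta_form (x : F * bool -> C) Q b :
  coef b (\sum_y x y *: eta_form y) Q = x (Q, b).
Proof.
apply: (@coef_unique _ (fun b => x (Q, b))) => d.
by rewrite mem_face => /eqP <-; rewrite sum_eta_form.
Qed.

Lemma abelian_eta_form w : abelian_differential w ->
  w = \sum_y coef y.2 w y.1 *: eta_form y.
Proof.
move=> wA; have w1 := wA.1; apply/ffunP => -[d b].
have wd : w (d, true) = (\sum_y coef y.2 w y.1 *: eta_form y) (d, true).
  by rewrite sum_eta_form; apply: eta_expansion; apply: abelian_opposite.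
(* Both sides change sign under reversal, so agreement on the edges [(d, true)] suffices. *)
case: b => //; have := (sum_eta_form_abelian (fun y => coef y.2 w y.1)).1.
by move=> /(_ (d, true)) ->; rewrite -wd -w1.
Qed.

(** * The matrix of the pairing of functions with differentials *)

Definition pairing (v : V) (y : F * bool) : C :=
  \sum_(d in val v) eta_form y (d, true).

(** Passes from corners grouped by vertices to corners grouped by faces; only the face [y.1]
    supporting [eta_form y] remains. *)
Lemma sum_pairing f y :
  \sum_v f v * pairing v y = \sum_(d in val y.1) f (org d) * eta y.2 d.
Proof.
transitivity (\sum_d f (org d) * eta_form y (d, true)).
  rewrite -[RHS](@sum_cells _ (vnext S)); apply: eq_bigr => v _.
  rewrite mulr_sumr; apply: eq_bigr => d; rewrite mem_vertex => /eqP vd.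
  by rewrite -vd.
rewrite [RHS]big_mkcond; apply: eq_bigr => d _; rewrite ffunE mem_face.
by case: ifP => _; [rewrite mul1r | exact: mulr0].
Qed.

(** The edges [(d, true)] run clockwise around F_v; neither this sign nor the factor 2 pi i affects
    vanishing. *)
Lemma res_eq0 w v : one_form w ->
  (res w v == 0) = (\sum_(d in val v) w (d, true) == 0).
Proof.
move=> w1; have tpi : (2 * (trigo.pi : R)%:C%C * 'i%C)^-1 != 0 :> C.
  rewrite invr_eq0 !mulf_neq0 ?pnatr_eq0 //.
    by rewrite (inj_eq (@complexI R)) gt_eqF // trigo.pi_gt0.
  by rewrite eq_complex /= oner_eq0 andbF.
rewrite /res mulf_eq0 (negPf tpi) /=.
rewrite (eq_bigr (fun d => - w (d, true))) ?sumrN ?oppr_eq0 // => d _.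
exact: (w1 (d, true)).
Qed.

(** * Admissible divisors as selections of rows and columns *)

Section Admissible.

Variables (D : formal_sum S) (DA : admissible D).

Definition free_vertices : {set V} := [set v | D (inl v) == 0].

(** At Q, the coefficient -2 allows both basis forms, 0 only dz_Q, and 1 neither. *)
Definition allowed_forms : {set F * bool} :=
  [set y | if y.2 then D (inr y.1) != 1 else D (inr y.1) == -2].

Lemma admissible_vertex v : D (inl v) = -1 \/ D (inl v) = 0.
Proof. by case: DA => _ /(_ v) + _; rewrite !inE => /orP[]/eqP; [left|right]. Qed.

Lemma admissible_face Q : [\/ D (inr Q) = -2, D (inr Q) = 0 | D (inr Q) = 1].
Proof.
case: DA => _ _ /(_ Q); rewrite !inE.
by case/or3P=> /eqP; [apply: Or31 | apply: Or32 | apply: Or33].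
Qed.

(** Each allowed form kills the component of df along the other basis form, as [coef_df] requires:
    D(Q) = -2 forces df = 0 on Q, D(Q) = 0 forbids a pole, and D(Q) = 1 imposes nothing. *)
Lemma LP f : L (- D) f <->
  (forall v, v \notin free_vertices -> f v = 0) /\
  (forall y, y \in allowed_forms -> coef (~~ y.2) (df f) y.1 = 0).
Proof.
have fA := df_abelian f.
(* The zero function has coefficient 1 at every vertex and 2 at every face, so its divisor dominates
   -D. *)
have -> : L (- D) f <-> div_ge (div_fun f) (- D).
  split=> [[->|//]|]; last by right.
  have df0 : df (0 : {ffun V -> C^o}) = 0.
    by apply/ffunP => e; rewrite !ffunE subrr mul0r.
  have z0 Q : form_zero (0 : {ffun medge S -> C^o}) Q.
    by apply/form_zeroP => d _; rewrite ffunE.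
  case=> [v|Q]; rewrite !ffunE ?df0.
    by rewrite eqxx; case: (admissible_vertex v) => ->.
  rewrite z0 (negPf (zero_no_double_pole (z0 Q))).
  by case: (admissible_face Q) => ->.
split=> [fD|[fv fQ]].
  split=> [v|[Q b]]; rewrite inE /=.
    have := fD (inl v); rewrite !ffunE.
    by case: (admissible_vertex v) => ->; case: (f v =P 0).
  have := fD (inr Q); rewrite !ffunE.
  have Z := @form_zero_coef (df f) Q fA; have P := @no_double_pole_coef (df f) Q fA.
  have [zf|nzf] := boolP (form_zero _ _).
    by move=> _ _; case/Z: zf; case: b.
  have [pf|] := boolP (double_pole _ _); last first.
    by move=> /P pf; case: b => //=; case: (admissible_face Q) => ->.
  by case: b => /=; case: (admissible_face Q) => ->.
case=> [v|Q]; rewrite !ffunE.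
  have := fv v; rewrite inE.
  by case: (admissible_vertex v) => -> // /(_ isT) ->; rewrite eqxx.
have := fQ (Q, true); have := fQ (Q, false); rewrite !inE /=.
have Z := @form_zero_coef (df f) Q fA; have P := @no_double_pole_coef (df f) Q fA.
case: (admissible_face Q) => -> /=.
- move=> /(_ isT) ct /(_ isT) cf; have zf := Z.2 (conj ct cf).
  by rewrite zf (negPf (zero_no_double_pole zf)).
- by move=> _ /(_ isT) /P /negPf ->; case: form_zero.
- by case: form_zero; case: double_pole.
Qed.

Lemma HP w : H D w <-> abelian_differential w /\
  (forall v, v \in free_vertices -> \sum_(d in val v) w (d, true) = 0) /\
  (forall y, y \notin allowed_forms -> coef y.2 w y.1 = 0).
Proof.
have z0 Q : form_zero (0 : {ffun medge S -> C^o}) Q.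
  by apply/form_zeroP => d _; rewrite ffunE.
(* The zero form has coefficient 0 at every vertex and 1 at every face, so its divisor dominates
   D. *)
have -> : H D w <-> abelian_differential w /\ div_ge (div_form w) D.
  split=> [[wA [w0|//]]|[wA]]; last by split=> //; right.
  split=> //; case=> [v|Q]; rewrite !ffunE.
    have -> : simple_pole w v = false.
      apply/negbTE; rewrite /simple_pole negbK (res_eq0 v wA.1) big1 // => d _.
      by rewrite w0 ffunE.
    by case: (admissible_vertex v) => ->.
  rewrite w0 z0 (negPf (zero_no_double_pole (z0 Q))).
  by case: (admissible_face Q) => ->.
split=> [[wA wD]|[wA [wv wQ]]]; split=> //.
  split=> [v|[Q b]]; rewrite inE /=.
    have := wD (inl v); rewrite !ffunE /simple_pole (res_eq0 v wA.1).
    by move=> le0 /eqP v0; move: le0; rewrite v0; case: eqP.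
  have := wD (inr Q); rewrite !ffunE.
  have Z := @form_zero_coef w Q wA; have P := @no_double_pole_coef w Q wA.
  have [zw|nzw] := boolP (form_zero _ _).
    by move=> _ _; case/Z: zw; case: b.
  have [pw|] := boolP (double_pole _ _); last first.
    by move=> /P pw; case: b => //=; case: (admissible_face Q) => ->.
  by case: b => /=; case: (admissible_face Q) => ->.
case=> [v|Q]; rewrite !ffunE.
  rewrite /simple_pole (res_eq0 v wA.1); have := wv v; rewrite inE.
  by case: (admissible_vertex v) => -> => [_|/(_ isT) ->]; [case: eqP | rewrite eqxx].
have := wQ (Q, true); have := wQ (Q, false); rewrite !inE /=.
have Z := @form_zero_coef w Q wA; have P := @no_double_pole_coef w Q wA.
case: (admissible_face Q) => -> /=.
- by case: form_zero; case: double_pole.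
- by move=> /(_ isT) /P /negPf -> _; case: form_zero.
- move=> /(_ isT) cf /(_ isT) ct; have zw := Z.2 (conj ct cf).
  by rewrite zw (negPf (zero_no_double_pole zw)).
Qed.

(** * Both spaces as kernels of one matrix *)

Let B := \matrix_(j < #|free_vertices|, k < #|allowed_forms|)
  pairing (enum_val j) (enum_val k).

Lemma l_rank : l (- D) = (#|free_vertices| - \rank B)%N.
Proof.
have [L0 Llin] := L_subspace (- D).
pose delta v : {ffun V -> C^o} := [ffun u => (u == v)%:R].
have sum_delta (x : V -> C) u : (\sum_v x v *: delta v) u = x u.
  rewrite sum_ffunE (bigD1 u) //= big1 => [|v nv].
    by rewrite addr0 !ffunE eqxx; exact: mulr1.
  by rewrite !ffunE eq_sym (negPf nv); exact: mulr0.
apply: (@vdim_kernel _ _ _ _ _ free_vertices allowed_forms pairing delta) => //.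
  by move=> x x0 v; rewrite -sum_delta x0 ffunE.
(* Turns the conditions on df into the column equations of the pairing matrix. *)
have coef0 f y : coef (~~ y.2) (df f) y.1 = 0 <-> \sum_v f v * pairing v y = 0.
  rewrite coef_df sum_pairing; split=> [/eqP|->]; last by rewrite mulr0 mul0r.
  by rewrite !mulf_eq0 signr_eq0 invr_eq0 (negPf (sqnorm_neq0 _)) orbF => /eqP.
move=> f; rewrite LP; split=> [[fv fQ]|[x [xv xQ fx]]].
  exists f; split=> // [y /fQ /coef0 //|].
  by apply/ffunP => v; rewrite sum_delta.
have fE v : f v = x v by rewrite fx sum_delta.
split=> [v /xv <- //|y /xQ xy]; apply/coef0; rewrite -[RHS]xy.
by apply: eq_bigr => v _; rewrite fE.
Qed.

(** H(D) is the left kernel of the transpose of [B], which has the same rank. *)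
Lemma i_rank : i D = (#|allowed_forms| - \rank B)%N.
Proof.
have [H0 Hlin] := H_subspace D; rewrite -mxrank_tr.
have -> : B^T = \matrix_(k, j) pairing (enum_val j) (enum_val k).
  by apply/matrixP => k j; rewrite !mxE.
apply: (@vdim_kernel _ _ _ _ _ allowed_forms free_vertices
          (fun y v => pairing v y) eta_form) => //.
  by move=> x x0 [Q b]; rewrite -coef_sum_eta_form x0 (@coef_eta0 _ _ 0) // => d _;
    rewrite ffunE mul0r.
have sum_res (x : F * bool -> C) (v : V) :
    \sum_(d in val v) (\sum_y x y *: eta_form y) (d, true) =
    \sum_y x y * pairing v y.
  under eq_bigr do rewrite sum_ffunE.
  rewrite exchange_big /=; apply: eq_bigr => y _; rewrite mulr_sumr.
  by apply: eq_bigr => d _; rewrite [LHS]ffunE.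
move=> w; rewrite HP; split=> [[wA [wv wQ]]|[x [xQ xv ->]]].
  exists (fun y => coef y.2 w y.1); split=> // [v /wv wv0|].
    by rewrite -sum_res -abelian_eta_form.
  exact: abelian_eta_form.
split; first exact: sum_eta_form_abelian.
split=> [v /xv|[Q b] /xQ]; first by rewrite sum_res.
by rewrite coef_sum_eta_form.
Qed.

(** As D(v) is 0 or -1, the indicator of D(v) = 0 is 1 + D(v). *)
Lemma card_free_vertices :
  #|free_vertices|%:Z = #|{: V}|%:Z + \sum_v D (inl v).
Proof.
rewrite -!sum1_card big_mkcond !(big_morph Posz PoszD (erefl _)) -big_split /=.
by apply: eq_bigr => v _; rewrite inE; case: (admissible_vertex v) => ->.
Qed.

(** A face contributes 2, 1 or 0 basis forms for D(Q) = -2, 0 or 1, that is 1 - sign D(Q). *)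
Lemma card_allowed_forms :
  #|allowed_forms|%:Z = #|{: F}|%:Z - \sum_Q Num.sg (D (inr Q)).
Proof.
have -> : #|allowed_forms| = (\sum_Q \sum_b ((Q, b) \in allowed_forms))%N.
  by rewrite -sum1_card big_mkcond pair_bigA; apply: eq_bigr => -[Q b] _; case: ifP.
rewrite -sum1_card !(big_morph Posz PoszD (erefl _)) -sumrN -big_split /=.
apply: eq_bigr => Q _; rewrite big_bool /= !inE /=.
by case: (admissible_face Q) => ->.
Qed.

End Admissible.
End FaceBasis.

Theorem theorem7p8 (R : realType) (S : discrete_RS R) (g : nat)
    (D : formal_sum S) (hg : has_genus S g) (hD : admissible D) :
  (l (- D))%:Z = deg D - 2 * g%:Z + 2 + (i D)%:Z.
Proof.
have VF : _ - _ = 2 - 2 * g%:Z := etrans (esym (euler_char_quad (qmapP S))) hg.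
(* The rank is at most either size of the matrix, so both truncated subtractions are exact and the
   rank cancels. *)
rewrite (l_rank hD) i_rank // -!subzn ?rank_leq_row ?rank_leq_col //.
rewrite card_free_vertices // card_allowed_forms // /deg (canRL (subrK _) VF).
by ring.
Qed.
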